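(* Let $\Omega\subset\mathbb{R}^n$ be a bounded domain, $\varepsilon>0$, and $\alpha,\beta>0$ with $\alpha+\beta=1$. Given a bounded Borel function $F:\Gamma_\varepsilon\to\mathbb{R}$, there is a bounded Borel function $u:\Omega_\varepsilon\to\mathbb{R}$ such that $u=Tu$ on $\Omega_\varepsilon$ and $u|_{\Gamma_\varepsilon}=F$. In fact, $u$ is the uniform limit on $\Omega_\varepsilon$ $$u=\lim_{j\to\infty}u_j,\qquad u_{j+1}=Tu_j\ \text{ for } j=0,1,2,\ldots,$$ where the starting point of the iteration is $$u_0(x)=\begin{cases}\inf_{y\in\Gamma_\varepsilon}F(y), & x\in\Omega,\\ F(x), & x\in\Gamma_\varepsilon.\end{cases}$$
   Context: $B_\varepsilon(x)$ denotes the open ball of radius $\varepsilon$ centred at $x$, and $|\cdot|$ of a set is Lebesgue measure. The $\varepsilon$-boundary strip is $\Gamma_\varepsilon=\{x\in\mathbb{R}^n\setminus\Omega:\operatorname{dist}(x,\Omega)\le\varepsilon\}$, and $\Omega_\varepsilon=\Gamma_\varepsilon\cup\Omega$. For a bounded Borel function $u:\Omega_\varepsilon\to\mathbb{R}$, the function $Tu:\Omega_\varepsilon\to\mathbb{R}$ is defined by $$Tu(x)=\begin{cases}\dfrac{\alpha}{2}\sup_{B_\varepsilon(x)}u+\dfrac{\alpha}{2}\inf_{B_\varepsilon(x)}u+\dfrac{\beta}{|B_\varepsilon(x)|}\displaystyle\int_{B_\varepsilon(x)}u\,dy, & x\in\Omega,\\[2mm] u(x), & x\in\Gamma_\varepsilon.\end{cases}$$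 (For bounded Borel $u$, $Tu$ is again bounded and Borel.) *)

(* Defs.v *)
From HB Require Import structures.
From mathcomp Require Import all_boot all_order all_algebra.
From mathcomp Require Import all_classical all_reals all_analysis measurable_realfun.
Set Implicit Arguments.
Unset Strict Implicit.
Unset Printing Implicit Defensive.
Import Order.TTheory GRing.Theory Num.Theory.
Import numFieldNormedType.Exports.
Local Open Scope classical_set_scope.
Local Open Scope ring_scope.

Definition borel_rV_display : measure_display. Proof. exact. Qed.

Section borel_rV.
Context {R : realType} {n : nat}.
Implicit Types A : set 'rV[R]_n.

Let borel0 : <<s @open 'rV[R]_n >> set0.
Proof. exact: sigma_algebra0. Qed.

Let borelC A : <<s open >> A -> <<s open >> (~` A).
Proof. by move=> ?; rewrite -setTD; exact: sigma_algebraCD. Qed.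

Let borel_bigcup (B : (set 'rV[R]_n)^nat) :
  (forall i, <<s open >> (B i)) -> <<s open >> (\bigcup_i B i).
Proof. exact: sigma_algebra_bigcup. Qed.

(* The measurable subsets of R^n are the Borel sets. *)
HB.instance Definition _ := @isMeasurable.Build borel_rV_display 'rV[R]_n
  <<s open >> borel0 borelC borel_bigcup.

Lemma open_measurable_rV A : open A -> measurable A.
Proof. by move=> oA; apply: sub_sigma_algebra. Qed.

Lemma continuous_measurable_rV (f : 'rV[R]_n -> R) :
  continuous f -> measurable_fun setT f.
Proof.
move=> cf; apply: (measurability _ (RGenOpens.measurableE R)) => _ [_ [a [b ->] <-]].
rewrite setTI; apply: open_measurable_rV.
by move/continuousP : cf; apply; exact: interval_open.
Qed.

Lemma measurable_coord_rV (j : 'I_n) :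
  measurable_fun setT (fun v : 'rV[R]_n => v ord0 j).
Proof. by apply: continuous_measurable_rV => v; exact: coord_continuous. Qed.

(* every open set is a union of rational max-norm balls contained in it *)
Lemma measurable_rVP d (T : measurableType d) (f : T -> 'rV[R]_n) :
  (forall j, measurable_fun setT (fun x => f x ord0 j)) ->
  measurable_fun setT f.
Proof.
move=> mf.
apply: (@measurability _ _ _ _ setT f (@open 'rV[R]_n)) => // _ [U oU <-].
rewrite setTI.
pose box (p : 'rV[rat]_n * rat) : set 'rV[R]_n :=
  [set v | forall j, `|v ord0 j - ratr (p.1 ord0 j)| < ratr p.2].
pose D : set ('rV[rat]_n * rat) := [set p | box p `<=` U].
have -> : U = \bigcup_p (if p \in D then box p else set0).
  apply/seteqP; split => [v Uv|v [p _]]; last first.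
    by case: ifPn => // /set_mem; exact.
  have /nbhs_ballP[e /= e0 eU] : nbhs v U by exact: open_nbhs_nbhs.
  have [r] : exists r : rat, 0 < (ratr r : R) < e / 2.
    have [q ] := rat_in_itvoo (divr_gt0 e0 (ltr0n _ 2)).
    by rewrite in_itv /= => ?; exists q.
  move=> /andP[r0 re].
  have /choice[q Hq] : forall j, exists q : rat, `|v ord0 j - ratr q| < ratr r.
    move=> j; have [|q] := @rat_in_itvoo R (v ord0 j - ratr r) (v ord0 j + ratr r).
      by rewrite ltrBlDr -addrA ltrDl addr_gt0.
    rewrite in_itv /= => /andP[q1 q2]; exists q.
    by rewrite distrC ltr_distl q1.
  exists (\row_j q j, r) => //; rewrite mem_set.
    by move=> j /=; rewrite mxE.
  move=> w bw; apply: eU; split => //= i j; rewrite (ord1 i).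
  have := bw j; have := Hq j; rewrite /= mxE => h1 h2.
  rewrite /ball /= (_ : _ - _ =
    (v ord0 j - ratr (q j)) - (w ord0 j - ratr (q j))); last first.
    by rewrite opprB addrA subrK.
  apply: le_lt_trans (ler_normB _ _) _.
  by rewrite (splitr e) ltrD// (lt_trans _ re).
rewrite preimage_bigcup; apply: countable_bigcupT_measurable.
  exact: countableP.
move=> p; case: ifPn => _; last by rewrite preimage_set0.
rewrite [X in measurable X](_ : _ = \bigcap_(j in [set: 'I_n])
    [set x | `|f x ord0 j - ratr (p.1 ord0 j)| < ratr p.2]); last first.
  by apply/seteqP; split => x /= h j; [move=> _|]; exact: h.
apply: fin_bigcap_measurable => [|j _]; first exact: finite_finset.
have mg : measurable_fun setT (fun x => `|f x ord0 j - ratr (p.1 ord0 j)|).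
  apply: measurableT_comp => //; apply: measurable_funB => //; exact: mf.
have := mg measurableT `]-oo, ratr p.2[%classic (measurable_itv _).
rewrite setTI; congr (measurable _).
Qed.
End borel_rV.

Section lebesgue_rV.
Context {R : realType}.

Definition cons_rV n (p : measurableTypeR R * 'rV[R]_n) : 'rV[R]_n.+1 :=
  \row_j (if unlift ord0 j is Some k then p.2 ord0 k else p.1).

Definition behead_rV n (v : 'rV[R]_n.+1) : 'rV[R]_n :=
  \row_k v ord0 (lift ord0 k).

Lemma cons_rVK n (p : measurableTypeR R * 'rV[R]_n) :
  ((cons_rV p) ord0 ord0, behead_rV (cons_rV p)) = p.
Proof.
case: p => x v; congr (_, _); first by rewrite mxE unlift_none.
by apply/rowP => k; rewrite !mxE liftK.
Qed.

Lemma measurable_cons_rV n : measurable_fun setT (@cons_rV n).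
Proof.
apply: measurable_rVP => j; case: (unliftP ord0 j) => [k ->|->].
  rewrite (_ : (fun _ => _) = (fun v : 'rV[R]_n => v ord0 k) \o snd).
    by apply: measurableT_comp => //; exact: measurable_coord_rV.
  by apply/funext => p; rewrite /= mxE liftK.
rewrite (_ : (fun _ => _) = fst) //.
by apply/funext => p; rewrite mxE unlift_none.
Qed.

Lemma measurable_behead_rV n : measurable_fun setT (@behead_rV n).
Proof.
apply: measurable_rVP => j.
rewrite (_ : (fun _ => _) = (fun v : 'rV[R]_n.+1 => v ord0 (lift ord0 j))).
  exact: measurable_coord_rV.
by apply/funext => p; rewrite mxE.
Qed.

Section step.
Variables (n : nat) (mu : {sigma_finite_measure set 'rV[R]_n -> \bar R}).

(* Lebesgue measure on R times mu, transported to row vectors of size n.+1 *)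
Definition lebesgue_cons : set 'rV[R]_n.+1 -> \bar R :=
  pushforward (@lebesgue_measure R \x mu)%E (@cons_rV n).

Let nu : {measure set 'rV[R]_n.+1 -> \bar R} :=
  measure_function_pushforward__canonical__measure_function_Measure
    (@lebesgue_measure R \x mu)%E (@measurable_cons_rV n).

HB.instance Definition _ := isMeasure.Build _ _ _ lebesgue_cons
  (measure0 nu) (measure_ge0 nu) (@measure_semi_sigma_additive _ _ _ nu).

Let lebesgue_cons_sigma_finite : sigma_finite setT lebesgue_cons.
Proof.
have /sigma_finiteP[F [TF ndF Foo]] := sigma_finiteT (@lebesgue_measure R).
have /sigma_finiteP[G [TG ndG Goo]] := sigma_finiteT mu.
have mh : measurable_fun setT (fun v : 'rV[R]_n.+1 => v ord0 ord0).
  exact: measurable_coord_rV.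
exists (fun k => (fun v : 'rV[R]_n.+1 => v ord0 ord0) @^-1` F k `&`
    (@behead_rV n) @^-1` G k).
  apply/esym; rewrite -subTset => v _.
  have [a _ Fa] : (\bigcup_i F i) (v ord0 ord0) by rewrite -TF.
  have [b _ Gb] : (\bigcup_i G i) (behead_rV v) by rewrite -TG.
  exists (maxn a b) => //; split.
  - have /subsetPset sub := ndF _ _ (leq_maxl a b); exact: sub.
  - have /subsetPset sub := ndG _ _ (leq_maxr a b); exact: sub.
move=> k; have [mF Fk] := Foo k; have [mG Gk] := Goo k; split.
  apply: measurableI; rewrite -[X in measurable X]setTI; first exact: mh.
  exact: measurable_behead_rV.
rewrite /lebesgue_cons /pushforward (_ : _ @^-1` _ = F k `*` G k).
  by rewrite product_measure1E// lte_mul_pinfty// ge0_fin_numE.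
apply/funext => p; rewrite /preimage /setI /setX /=.
by have /(congr1 fst) /= -> := cons_rVK p; have /(congr1 snd) /= -> := cons_rVK p.
Qed.

HB.instance Definition _ := @Measure_isSigmaFinite.Build _ _ _ lebesgue_cons
  lebesgue_cons_sigma_finite.

End step.

Fixpoint lebesgue_rV n : {sigma_finite_measure set 'rV[R]_n -> \bar R} :=
  if n is m.+1 return {sigma_finite_measure set 'rV[R]_n -> \bar R}
  then lebesgue_cons (lebesgue_rV m) else \d_(0 : 'rV[R]_0).

Lemma lebesgue_rV_box n (A : 'I_n -> set (measurableTypeR R)) :
  (forall j, measurable (A j)) ->
  lebesgue_rV n [set v | forall j, A j (v ord0 j)] =
  (\prod_(j < n) lebesgue_measure (A j))%E.
Proof.
elim: n A => [|n IH] A mA.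
  by rewrite big_ord0 /= diracE mem_set// => -[].
rewrite big_ord_recl /= /lebesgue_cons /pushforward.
rewrite [X in product_measure1 _ _ X](_ : _ =
    A ord0 `*` [set v : 'rV[R]_n | forall j, A (lift ord0 j) (v ord0 j)]).
  rewrite product_measure1E//; first by rewrite -IH.
  rewrite [X in measurable X](_ : _ = \bigcap_(j in [set: 'I_n])
      ((fun v : 'rV[R]_n => v ord0 j) @^-1` A (lift ord0 j))).
    apply: fin_bigcap_measurable => [|j _]; first exact: finite_finset.
    by rewrite -[X in measurable X]setTI; apply: measurable_coord_rV => //; exact: mA.
  by apply/seteqP; split => x /= h j; [move=> _|]; exact: h.
apply/seteqP; split => -[x v] /= h.
  split => [|j]; first by have := h ord0; rewrite mxE unlift_none.
  by have := h (lift ord0 j); rewrite mxE liftK.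
case: h => h0 h1 j.
by case: (unliftP ord0 j) => [k ->|->]; rewrite mxE ?liftK ?unlift_none.
Qed.

End lebesgue_rV.

Section euclidean.
Context {R : realType} {n : nat}.
Implicit Types (x y : 'rV[R]_n) (A Omega : set 'rV[R]_n) (eps : R).

(* The library's norm `|x| on row vectors is the max norm, and its balls are
   cubes: Euclidean balls and distances are needed here. The two norms induce
   the same topology and the same bounded sets. *)
Definition euclid_norm x : R := Num.sqrt (\sum_(j < n) x ord0 j ^+ 2).

Definition euclid_ball x eps : set 'rV[R]_n :=
  [set y | euclid_norm (y - x) < eps].

Definition euclid_dist x A : R := inf [set euclid_norm (x - y) | y in A].

Definition domain Omega := [/\ open Omega, connected Omega & Omega !=set0].

Definition boundary_strip Omega eps : set 'rV[R]_n :=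
  [set x | ~ Omega x /\ euclid_dist x Omega <= eps].

Definition extended_domain Omega eps : set 'rV[R]_n :=
  boundary_strip Omega eps `|` Omega.

Lemma continuous_euclid_norm : continuous euclid_norm.
Proof.
move=> x; apply: (@continuous_comp _ _ _
  (fun x : 'rV[R]_n => \sum_(j < n) x ord0 j ^+ 2) Num.sqrt); last first.
  exact: sqrt_continuous.
have cadd : continuous (fun p : R * R => p.1 + p.2) by exact: add_continuous.
move: x; apply: (continuous_big cadd) => j _ v.
apply: (@continuous_comp _ _ _ (fun v : 'rV[R]_n => v ord0 j)
  (fun r : R => r ^+ 2)); first exact: coord_continuous.
exact: exprn_continuous.
Qed.

Lemma open_euclid_ball x eps : open (euclid_ball x eps).
Proof.
have cf : continuous (fun y => euclid_norm (y - x)).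
  move=> y; apply: (@continuous_comp _ _ _ (fun y => y - x) euclid_norm).
    by apply: (@continuousB _ _ _ id (cst x)) => //; exact: cst_continuous.
  exact: continuous_euclid_norm.
rewrite (_ : euclid_ball _ _ = (fun y => euclid_norm (y - x)) @^-1` `]-oo, eps[).
  by move/continuousP : cf; apply; exact: interval_open.
by apply/seteqP; split => y /=; rewrite in_itv.
Qed.

Lemma measurable_boundary_strip Omega eps :
  domain Omega -> measurable (boundary_strip Omega eps).
Proof.
move=> [oO _ [y0 Oy0]].
rewrite (_ : boundary_strip _ _ = ~` Omega `&`
    \bigcap_k \bigcup_(y in Omega) euclid_ball y (eps + k.+1%:R^-1)).
  apply: measurableI; first by apply: measurableC; exact: open_measurable_rV.
  apply: bigcapT_measurable => k; apply: open_measurable_rV.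
  by apply: bigcup_open => y _; exact: open_euclid_ball.
have hi x : has_inf [set euclid_norm (x - y) | y in Omega].
  split; first by exists (euclid_norm (x - y0)), y0.
  by exists 0 => _ [y _ <-]; exact: sqrtr_ge0.
apply/seteqP; split => x /= [nO h]; split => //.
  move=> k _; have [|_ [y Oy <-] hy] := @inf_adherent _ _ k.+1%:R^-1 _ (hi x).
    by rewrite invr_gt0.
  exists y => //; rewrite /euclid_ball /=; apply: lt_le_trans hy _.
  by rewrite lerD2r.
apply/ler_addgt0Pr => e e0.
have [k ke] : exists k, k.+1%:R^-1 < e.
  have [k _ /(_ k (leqnn _))] := near_infty_natSinv_lt (PosNum e0).
  by exists k.
have [y Oy /ltW hy] := h k I.
apply: (@le_trans _ _ (euclid_norm (x - y))).
  by apply: ge_inf; [exact: (hi x).2|exists y].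
by rewrite (le_trans hy)// lerD2l ltW.
Qed.

Lemma measurable_extended_domain Omega eps :
  domain Omega -> measurable (extended_domain Omega eps).
Proof.
move=> dO; apply: measurableU; first exact: measurable_boundary_strip.
by apply: open_measurable_rV; case: dO.
Qed.

(* Functions on the extended domain are represented by total functions on R^n;
   for eps > 0, the values of mean_op on the extended domain only depend on
   those of u there. *)
Definition mean_op Omega eps (alpha beta : R) (u : 'rV[R]_n -> R) x : R :=
  let B := euclid_ball x eps in
  if x \in Omega then
    alpha / 2 * sup (u @` B) + alpha / 2 * inf (u @` B)
    + beta / fine (lebesgue_rV n B) * \int[lebesgue_rV n]_(y in B) u y
  else u x.

Definition initial_fun Omega eps (F : 'rV[R]_n -> R) x : R :=
  if x \in Omega then inf (F @` boundary_strip Omega eps) else F x.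

End euclidean.

(* Main.v *)
Require Import Defs.
From mathcomp Require Import all_boot all_order all_algebra.
From mathcomp Require Import all_classical all_reals all_analysis.
From mathcomp Require Import measurable_realfun ring lra.
Import Order.TTheory GRing.Theory Num.Theory.
Import numFieldNormedType.Exports.
Local Open Scope classical_set_scope.
Local Open Scope ring_scope.

(** Write [T] for the mean operator and [u_ k] for its iterates.

    The operator [T] is monotone and fixes the constants.  The starting point
    is the constant [m = inf F] on [Omega] and is at least [m] everywhere, so
    [u_ 0 <= T (u_ 0)]; hence the iterates increase, they stay bounded by a
    bound of [F], and they converge pointwise to some bounded Borel function
    [u], with [u <= T u] by monotonicity.

    The point is that this convergence is uniform.  If [u - u_ k <= M]
    everywhere, then the sup and inf terms of [T u - T (u_ k)] contribute at
    most [alpha * M], while the integral term is at most a constant times the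
    integral of [u - u_ k] over [Omega] ([mean_op_sub_iterS]): the difference
    vanishes off [Omega], and the balls of radius [eps] all have volume at
    least that of a fixed cube.  By dominated convergence this integral tends
    to [0] ([gap_cvg0]).  Since [u <= T u], the gap [u - u_ k.+1] obeys the same
    bound as [T u - u_ k.+1], and the bounds [M k] so obtained satisfy
    [M k.+1 = alpha * M k + c k] with [c k] tending to [0] and [alpha < 1], so
    they tend to [0] ([cvg0_affine_recurrence]).  This gives uniform
    convergence, and also [T u <= u] in the limit, that is [T u = u].

    Preservation of Borel measurability by [T] comes from two facts: the
    supremum over [B_eps(x)] is a lower semicontinuous function of [x] whatever
    the bounded function, and the integral over [B_eps(x)] is measurable in [x]
    by Tonelli's theorem.

    Finally, the values of functions outside of the extended domain do not
    influence the iteration on it ([eq_in_iter_mean_op]), which allows working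
    with functions that are bounded and Borel on all of R^n. *)

(** * Euclidean balls: shape and volume *)

Section geometry.
Context {R : realType} {n : nat}.
Implicit Types (x y : 'rV[R]_n) (eps r : R).

Lemma euclid_normN x : euclid_norm (- x) = euclid_norm x.
Proof.
by congr Num.sqrt; apply: eq_bigr => j _; rewrite mxE sqrrN.
Qed.

Lemma euclid_ballC x y eps : euclid_ball x eps y -> euclid_ball y eps x.
Proof. by rewrite /euclid_ball /= -opprB euclid_normN. Qed.

Lemma euclid_ball_center x {eps} : 0 < eps -> euclid_ball x eps x.
Proof.
move=> e0; rewrite /euclid_ball /= /euclid_norm big1 ?sqrtr0// => j _.
by rewrite !mxE subrr expr0n.
Qed.

Lemma euclid_ball_sub_extended (Omega : set 'rV[R]_n) eps x :
  Omega x -> euclid_ball x eps `<=` extended_domain Omega eps.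
Proof.
move=> Ox y xy; have [Oy|nOy] := pselect (Omega y); [by right|left; split=> //].
have /ltW := euclid_ballC _ _ _ xy; rewrite -opprB euclid_normN => yx.
apply: le_trans yx; apply: ge_inf; last by exists x.
by exists 0 => _ [z _ <-]; exact: sqrtr_ge0.
Qed.

Definition cube x r : set 'rV[R]_n :=
  [set v | forall j, `]x ord0 j - r, x ord0 j + r[%classic (v ord0 j)].

Lemma measurable_cube x r : measurable (cube x r).
Proof.
rewrite [X in measurable X](_ : _ = \bigcap_(j in [set: 'I_n])
    ((fun v : 'rV[R]_n => v ord0 j) @^-1` `]x ord0 j - r, x ord0 j + r[)).
  apply: fin_bigcap_measurable => [|j _]; first exact: finite_finset.
  by rewrite -[X in measurable X]setTI; apply: measurable_coord_rV.
by apply/seteqP; split => v /= h j; [move=> _|]; exact: h.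
Qed.

Lemma lebesgue_cube x {r} : 0 < r ->
  lebesgue_rV n (cube x r) = ((r *+ 2) ^+ n)%:E.
Proof.
move=> r0; rewrite (@lebesgue_rV_box _ _ (fun j => `]x ord0 j - r, x ord0 j + r[%classic))//.
rewrite (eq_bigr (fun=> (r *+ 2)%:E)) => [|j _].
  by rewrite prodEFin prodr_const card_ord.
rewrite lebesgue_measure_itv /= lte_fin ltrBlDr -addrA ltrDl addr_gt0//.
by rewrite -EFinB; congr EFin; ring.
Qed.

Lemma euclid_ball_sub_cube x eps : euclid_ball x eps `<=` cube x eps.
Proof.
move=> y xy j /=; rewrite in_itv /= -ltr_distl.
apply: le_lt_trans xy; rewrite -sqrtr_sqr ler_wsqrtr//.
rewrite (bigD1 j)//= !mxE lerDl; apply: sumr_ge0 => k _.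
exact: sqr_ge0.
Qed.

(** The half-side [eps / n.+1] rather than [eps / n] keeps the sum of the [n]
    squares strictly below [eps ^+ 2], in every dimension. *)
Lemma cube_sub_euclid_ball x {eps} : 0 < eps ->
  cube x (eps / n.+1%:R) `<=` euclid_ball x eps.
Proof.
move=> e0 y xy; rewrite /euclid_ball /= -[ltRHS]gtr0_norm// -sqrtr_sqr.
rewrite ltr_sqrt ?exprn_gt0//.
apply: (@le_lt_trans _ _ (\sum_(j < n) (eps / n.+1%:R) ^+ 2)).
  apply: ler_sum => j _; rewrite -real_normK ?num_real// !mxE.
  rewrite lerXn2r ?nnegrE// ?divr_ge0 ?(ltW e0)//.
  by have := xy j; rewrite /= in_itv /= -ltr_distl => /ltW.
rewrite sumr_const card_ord exprMn -mulrnAr -[ltRHS]mulr1 ltr_pM2l ?exprn_gt0//.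
rewrite exprVn -[X in X < _]mulr_natl ltr_pdivrMr ?exprn_gt0// mul1r -natrX ltr_nat.
by rewrite (@leq_trans n.+1)// leq_pmulr.
Qed.

Lemma measurable_euclid_ball x eps : measurable (euclid_ball x eps).
Proof. by apply: open_measurable_rV; exact: open_euclid_ball. Qed.

Lemma lebesgue_euclid_ball_lty x {eps} : 0 < eps ->
  (lebesgue_rV n (euclid_ball x eps) < +oo)%E.
Proof.
move=> e0; apply: (@le_lt_trans _ _ (lebesgue_rV n (cube x eps))).
  apply: le_measure; rewrite ?inE; [exact: measurable_euclid_ball| |].
  - exact: measurable_cube.
  - exact: euclid_ball_sub_cube.
by rewrite lebesgue_cube// ltry.
Qed.

(** A lower bound independent of the centre: it bounds the averages over all the
    balls at once, which uniform convergence requires. *)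
Lemma le_volume_euclid_ball x {eps} : 0 < eps ->
  (eps / n.+1%:R *+ 2) ^+ n <= fine (lebesgue_rV n (euclid_ball x eps)).
Proof.
move=> e0; have r0 : 0 < eps / n.+1%:R by rewrite divr_gt0.
rewrite -lee_fin fineK ?ge0_fin_numE ?lebesgue_euclid_ball_lty//.
rewrite -(lebesgue_cube x r0); apply: le_measure; rewrite ?inE.
- exact: measurable_cube.
- exact: measurable_euclid_ball.
- exact: cube_sub_euclid_ball.
Qed.

Lemma volume_euclid_ball_gt0 x {eps} : 0 < eps ->
  0 < fine (lebesgue_rV n (euclid_ball x eps)).
Proof.
move=> e0; apply: lt_le_trans (le_volume_euclid_ball x e0).
by rewrite exprn_gt0// pmulrn_lgt0// divr_gt0.
Qed.

Lemma bounded_set_lebesgue_lty (A : set 'rV[R]_n) : measurable A ->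
  bounded_set A -> (lebesgue_rV n A < +oo)%E.
Proof.
move=> mA /ex_strict_bound_gt0[M M0 AM].
apply: (@le_lt_trans _ _ (lebesgue_rV n (cube 0 M))); last first.
  by rewrite lebesgue_cube ?ltry.
apply: le_measure; rewrite ?inE//; first exact: measurable_cube.
move=> x Ax j; rewrite /= in_itv /= -ltr_distl mxE subr0.
apply: le_lt_trans (AM _ Ax); rewrite -[leRHS]/(mx_norm x) mx_normrE.
exact: (le_bigmax _ (fun ij => `|x ij.1 ij.2|) (ord0, j)).
Qed.

End geometry.

(** * Borel measurability of the mean operator *)

Section measurability.
Context {R : realType} {n : nat}.
Implicit Types (x y : 'rV[R]_n) (u : 'rV[R]_n -> R).
Context {eps : R} (eps0 : 0 < eps).

Lemma image_euclid_ball_neq0 u x : u @` euclid_ball x eps !=set0.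
Proof. by exists (u x), x => //; exact: euclid_ball_center. Qed.

Lemma has_sup_image_euclid_ball u C : (forall x, `|u x| <= C) ->
  forall x, has_sup (u @` euclid_ball x eps).
Proof.
move=> uC x; split; first exact: image_euclid_ball_neq0.
by exists C => _ [y _ <-]; rewrite (le_trans (ler_norm _)).
Qed.

(** The supremum over a ball of radius [eps] exceeds [t] exactly at the points
    within distance [eps] of [u > t]; these form an open set, a union of balls. *)
Lemma measurable_sup_euclid_ball u C : (forall x, `|u x| <= C) ->
  measurable_fun setT (fun x => sup (u @` euclid_ball x eps)).
Proof.
move=> uC; apply: (measurability _ (RGenOInfty.measurableE R)).
move=> _ [_ [t ->] <-]; rewrite setTI; apply: open_measurable_rV.
rewrite [X in open X](_ : _ = \bigcup_(y in [set y | t < u y]) euclid_ball y eps).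
  by apply: bigcup_open => y _; exact: open_euclid_ball.
apply/seteqP; split => [x /=|x [y /= ty xy]]; rewrite in_itv /= andbT.
  move=> /(sup_gt (image_euclid_ball_neq0 u x))[_ [y xy <-] ty].
  by exists y => //; exact: euclid_ballC.
apply: (lt_le_trans ty); apply: ub_le_sup.
  by have [] := has_sup_image_euclid_ball u C uC x.
by exists y => //; exact: euclid_ballC.
Qed.

Lemma inf_imageE u (A : set 'rV[R]_n) : inf (u @` A) = - sup ((\- u) @` A).
Proof. by rewrite /inf image_comp. Qed.

Lemma measurable_inf_euclid_ball u C : (forall x, `|u x| <= C) ->
  measurable_fun setT (fun x => inf (u @` euclid_ball x eps)).
Proof.
move=> uC; under eq_fun do rewrite inf_imageE.
apply: measurable_funN; apply: (measurable_sup_euclid_ball _ C) => x.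
by rewrite normrN.
Qed.

Lemma measurable_euclid_ball_rel :
  measurable [set p : 'rV[R]_n * 'rV[R]_n | euclid_ball p.1 eps p.2].
Proof.
have mN : measurable_fun setT
    (fun p : 'rV[R]_n * 'rV[R]_n => euclid_norm (p.2 - p.1)).
  apply: (@measurableT_comp _ _ _ _ _ _ (@euclid_norm R n)).
    by apply: continuous_measurable_rV; exact: continuous_euclid_norm.
  apply: measurable_rVP => j.
  rewrite (_ : (fun _ => _) = ((fun v : 'rV[R]_n => v ord0 j) \o snd) \-
      ((fun v : 'rV[R]_n => v ord0 j) \o fst)); last first.
    by apply/funext => p; rewrite /= !mxE.
  by apply: measurable_funB; apply: measurableT_comp => //;
    exact: measurable_coord_rV.
have := mN measurableT `]-oo, eps[%classic (measurable_itv _).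
rewrite setTI; congr measurable.
Qed.

(** This is Tonelli's theorem for [f y] restricted to the pairs [(x, y)] at
    distance less than [eps]. *)
Lemma ge0_measurable_integral_euclid_ball (f : 'rV[R]_n -> \bar R) :
  measurable_fun setT f -> (forall x, 0 <= f x)%E ->
  measurable_fun setT (fun x => \int[lebesgue_rV n]_(y in euclid_ball x eps) f y)%E.
Proof.
move=> mf f0.
pose g := (fun p : 'rV[R]_n * 'rV[R]_n => f p.2) \_
  [set p : 'rV[R]_n * 'rV[R]_n | euclid_ball p.1 eps p.2].
have mg : measurable_fun setT g.
  apply/(measurable_restrictT _ measurable_euclid_ball_rel).
  by apply: measurable_funTS; exact: (measurableT_comp mf measurable_snd).
have g0 p : (0 <= g p)%E by rewrite /g patchE; case: ifP.
have := @measurable_fun_fubini_tonelli_F _ _ _ _ _ (lebesgue_rV n) g mg g0.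
congr measurable_fun; apply/funext => x; rewrite /fubini_F [RHS]integral_mkcond.
apply: eq_integral => y _; rewrite /g !patchE.
by congr (if _ then _ else _); apply/idP/idP; rewrite !inE.
Qed.

Lemma measurable_Rintegral_euclid_ball u : measurable_fun setT u ->
  measurable_fun setT (fun x => \int[lebesgue_rV n]_(y in euclid_ball x eps) u y).
Proof.
move=> /measurable_EFinP mu.
apply: (@measurableT_comp _ _ _ _ _ _ fine); first exact: fine_measurable.
under eq_fun do rewrite integralE.
apply: emeasurable_funB; apply: ge0_measurable_integral_euclid_ball => //.
- exact: measurable_funepos.
- exact: measurable_funeneg.
Qed.

(** Tonelli's theorem for the constant [1] gives the measurability of the volume,
    which spares a proof of translation invariance; the inverse is handled as a
    real power with exponent [-1], a measurable function. *)
Lemma measurable_inv_volume_euclid_ball :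
  measurable_fun setT (fun x : 'rV[R]_n => (fine (lebesgue_rV n (euclid_ball x eps)))^-1).
Proof.
rewrite (_ : (fun _ => _) = (fun r => r `^ (-1)) \o
    (fun x => \int[lebesgue_rV n]_(y in euclid_ball x eps) cst 1 y)).
  by apply: measurableT_comp => //; exact: measurable_Rintegral_euclid_ball.
apply/funext => x /=; rewrite Rintegral_cst; last exact: measurable_euclid_ball.
by rewrite mul1r powR_inv1// ltW// volume_euclid_ball_gt0.
Qed.

Lemma measurable_mean_op Omega alpha beta u C : measurable Omega ->
  (forall x, `|u x| <= C) -> measurable_fun setT u ->
  measurable_fun setT (mean_op Omega eps alpha beta u).
Proof.
move=> mO uC mu; apply: measurable_fun_ifT => //.
  apply: (measurable_fun_bool true); rewrite setTI.
  rewrite (_ : _ @^-1` _ = Omega)//; apply/seteqP; split => x /=.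
    by move/set_mem.
  by move/mem_set.
apply: measurable_funD; first apply: measurable_funD.
- apply: measurable_funM => //; exact: (measurable_sup_euclid_ball u C).
- apply: measurable_funM => //; exact: (measurable_inf_euclid_ball u C).
apply: measurable_funM; last exact: measurable_Rintegral_euclid_ball.
by apply: measurable_funM => //; exact: measurable_inv_volume_euclid_ball.
Qed.

End measurability.

(** * A scalar recurrence *)

(** Once [c] stays below [(1 - q) * (e / 2)], the excess of [`|a k|] over the
    level [e / 2] is contracted by [q] at each step. *)
Lemma cvg0_affine_recurrence {R : realType} (a c : R ^nat) (q : R) :
  0 <= q < 1 -> c @ \oo --> (0 : R) ->
  (forall k, a k.+1 = q * a k + c k) -> a @ \oo --> (0 : R).
Proof.
move=> /andP[q0 q1] c0 ac; apply/cvgrPdist_lt => e e0.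
have q'0 : 0 < 1 - q by rewrite subr_gt0.
have [N _ cN] : \forall k \near \oo, `|0 - c k| < (1 - q) * (e / 2).
  by move/cvgrPdist_lt : c0; apply; rewrite mulr_gt0// divr_gt0.
have aN j : `|a (N + j)%N| <= e / 2 + q ^+ j * `|a N|.
  elim: j => [|j IH]; first by rewrite addn0 expr0 mul1r lerDr divr_ge0// ltW.
  rewrite addnS ac; apply: le_trans (ler_normD _ _) _.
  rewrite normrM (ger0_norm q0).
  have := cN (N + j)%N (leq_addr _ _); rewrite /= sub0r normrN => /ltW cj.
  apply: le_trans (lerD (ler_wpM2l q0 IH) cj) _.
  by rewrite exprS le_eqVlt; apply/orP; left; apply/eqP; ring.
have [J _ gJ] : \forall j \near \oo, `|0 - geometric `|a N| q j| < e / 2.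
  have : geometric `|a N| q @ \oo --> (0 : R) by apply: cvg_geometric; rewrite ger0_norm.
  by move/cvgrPdist_lt; apply; rewrite divr_gt0.
exists (N + J)%N => // k /= NJk; rewrite sub0r normrN.
have Nk : (N <= k)%N by rewrite (leq_trans _ NJk)// leq_addr.
rewrite -(subnKC Nk); apply: le_lt_trans (aN _) _; rewrite [ltRHS]splitr ltrD2l.
have := gJ (k - N)%N; rewrite /= leq_subRL// => /(_ NJk).
by rewrite sub0r normrN /geometric /= mulrC; exact/le_lt_trans/ler_norm.
Qed.

(** * Comparison of the values of the mean operator *)

Section comparison.
Context {R : realType} {n : nat}.
Implicit Types (x y : 'rV[R]_n) (u v : 'rV[R]_n -> R).

Definition bounded_borel u :=
  measurable_fun setT u /\ exists C, forall x, `|u x| <= C.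

Lemma bounded_borel_integrable u (A : set 'rV[R]_n) : bounded_borel u ->
  measurable A -> (lebesgue_rV n A < +oo)%E ->
  (lebesgue_rV n).-integrable A (EFin \o u).
Proof.
move=> [mu [C uC]] mA Aoo; apply: measurable_bounded_integrable => //.
  exact: measurable_funTS.
exists C; split; first exact: num_real.
by move=> M CM x _; exact: le_trans (uC x) (ltW CM).
Qed.

Lemma bounded_borelB u v : bounded_borel u -> bounded_borel v ->
  bounded_borel (u \- v).
Proof.
move=> [mu [C uC]] [mv [D vD]]; split; first exact: measurable_funB.
by exists (C + D) => x; rewrite (le_trans (ler_normB _ _))// lerD.
Qed.

Lemma bounded_borel_cst c : bounded_borel (cst c).
Proof. by split => //; exists `|c|. Qed.

Lemma ge0_le_Rintegral_support u (A B : set 'rV[R]_n) : bounded_borel u ->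
  measurable A -> (lebesgue_rV n A < +oo)%E ->
  measurable B -> (lebesgue_rV n B < +oo)%E ->
  (forall x, 0 <= u x) -> (forall x, ~ A x -> u x = 0) ->
  \int[lebesgue_rV n]_(y in B) u y <= \int[lebesgue_rV n]_(y in A) u y.
Proof.
move=> bu mA Aoo mB Boo u0 uA.
apply: fine_le; try by apply: integrable_fin_num => //; exact: bounded_borel_integrable.
have mu : measurable_fun setT (EFin \o u) by apply/measurable_EFinP; case: bu.
rewrite integral_mkcond [leRHS]integral_mkcond; apply: ge0_le_integral => //.
- by move=> x _; rewrite patchE; case: ifP => // _; rewrite lee_fin.
- by apply/(measurable_restrictT _ mB); exact: measurable_funTS.
- by apply/(measurable_restrictT _ mA); exact: measurable_funTS.
move=> x _; rewrite !patchE; case: ifPn => xB; case: ifPn => xA //=.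
  by rewrite uA//; move/negP : xA; rewrite inE.
by rewrite lee_fin.
Qed.

Context {eps : R} (eps0 : 0 < eps).

Lemma sup_image_leD u v C M x : (forall x, `|u x| <= C) ->
  (forall y, euclid_ball x eps y -> v y <= u y + M) ->
  sup (v @` euclid_ball x eps) <= sup (u @` euclid_ball x eps) + M.
Proof.
move=> uC vuM; apply: ge_sup; first exact: image_euclid_ball_neq0.
move=> _ [y xy <-]; apply: (le_trans (vuM y xy)); rewrite lerD2r.
apply: ub_le_sup; last by exists y.
by have [] := has_sup_image_euclid_ball eps0 u C uC x.
Qed.

Lemma inf_image_leD u v C M x : (forall x, `|v x| <= C) ->
  (forall y, euclid_ball x eps y -> v y <= u y + M) ->
  inf (v @` euclid_ball x eps) <= inf (u @` euclid_ball x eps) + M.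
Proof.
move=> vC vuM; rewrite !inf_imageE lerNl opprD opprK lerBlDr.
apply: (sup_image_leD _ _ C) => [y|y xy]; first by rewrite normrN.
by have := vuM y xy => /= h; lra.
Qed.

Context (Omega : set 'rV[R]_n) (alpha beta : R).
Hypotheses (mO : measurable Omega).
Hypotheses (alpha0 : 0 <= alpha) (beta0 : 0 <= beta) (ab1 : alpha + beta = 1).

Local Notation T := (mean_op Omega eps alpha beta).

(** The sup and the inf each move by at most [M] under a perturbation of size [M],
    with total weight [alpha]; the integral term is kept exact, because only
    the integral of the perturbation, not its size, will be known to be small. *)
Lemma mean_op_leD u v M x : bounded_borel u -> bounded_borel v -> Omega x ->
  (forall y, euclid_ball x eps y -> v y <= u y + M) ->
  T v x <= T u x + (alpha * M + beta / fine (lebesgue_rV n (euclid_ball x eps)) *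
    \int[lebesgue_rV n]_(y in euclid_ball x eps) (v y - u y)).
Proof.
move=> bu bv Ox vuM; rewrite /mean_op mem_set//.
have [[mu [C uC]] [mv [D vD]]] := (bu, bv).
rewrite (RintegralB (measurable_euclid_ball _ _)); last 2 first.
- apply: bounded_borel_integrable => //; first exact: measurable_euclid_ball.
  exact: lebesgue_euclid_ball_lty.
- apply: bounded_borel_integrable => //; first exact: measurable_euclid_ball.
  exact: lebesgue_euclid_ball_lty.
have a2 : 0 <= alpha / 2 by rewrite divr_ge0.
have := ler_wpM2l a2 (sup_image_leD u v C M x uC vuM).
have := ler_wpM2l a2 (inf_image_leD u v D M x vD vuM).
set s := sup _; set s' := sup _; set i := inf _; set i' := inf _.
by move=> hi hs; rewrite mulrBr; lra.
Qed.

Lemma mean_op_notin u x : ~ Omega x -> T u x = u x.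
Proof. by move=> nO; rewrite /mean_op memNset. Qed.

(** Case [M = 0] of [mean_op_leD], where the integral is nonpositive. *)
Lemma le_mean_op u v : bounded_borel u -> bounded_borel v ->
  (forall x, v x <= u x) -> forall x, T v x <= T u x.
Proof.
move=> bu bv vu x; have [Ox|nOx] := pselect (Omega x); last first.
  by rewrite !mean_op_notin.
have vu0 y : euclid_ball x eps y -> v y <= u y + 0 by rewrite addr0.
apply: (le_trans (mean_op_leD _ _ _ _ bu bv Ox vu0)).
rewrite mulr0 add0r gerDl mulr_ge0_le0 ?divr_ge0 ?fine_ge0//.
rewrite -oppr_ge0 -mulN1r -RintegralZl; [|exact: measurable_euclid_ball|].
  by apply: Rintegral_ge0 => y _; rewrite mulN1r opprB subr_ge0.
apply: bounded_borel_integrable; [|exact: measurable_euclid_ball|].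
  exact: bounded_borelB.
exact: lebesgue_euclid_ball_lty.
Qed.

Lemma mean_op_cst c x : T (cst c) x = c.
Proof.
have [Ox|nOx] := pselect (Omega x); last by rewrite mean_op_notin.
have -> : T (cst c) x = alpha / 2 * sup [set c] + alpha / 2 * inf [set c]
    + beta / fine (lebesgue_rV n (euclid_ball x eps))
      * \int[lebesgue_rV n]_(y in euclid_ball x eps) c.
  rewrite /mean_op mem_set// (_ : cst c @` _ = [set c])//.
  apply/seteqP; split => [_ [y _ <-]//|_ ->].
  by exists x => //; exact: euclid_ball_center.
rewrite sup1 inf1 Rintegral_cst; last exact: measurable_euclid_ball.
rewrite mulrCA mulfVK ?gt_eqF ?volume_euclid_ball_gt0//.
rewrite (_ : beta = 1 - alpha); last by rewrite -ab1; ring.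
by field.
Qed.

Lemma mean_op_bound u C : bounded_borel u ->
  (forall x, `|u x| <= C) -> forall x, `|T u x| <= C.
Proof.
move=> bu uC x; rewrite ler_norml -{1}(mean_op_cst (- C) x) -{2}(mean_op_cst C x).
by apply/andP; split; apply: le_mean_op => //; try exact: bounded_borel_cst;
  move=> y; have := uC y; rewrite ler_norml => /andP[].
Qed.

Lemma bounded_borel_mean_op u : bounded_borel u -> bounded_borel (T u).
Proof.
move=> bu; have [mu [C uC]] := bu; split; last by exists C; exact: mean_op_bound.
exact: (measurable_mean_op eps0 _ _ _ _ C).
Qed.

End comparison.

(** * The increasing iteration and its uniform limit *)

Section iteration.
Context {R : realType} {n : nat}.
Context (Omega : set 'rV[R]_n) (eps alpha beta : R).
Hypotheses (mO : measurable Omega) (Ooo : (lebesgue_rV n Omega < +oo)%E).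
Hypotheses (eps0 : 0 < eps) (alpha0 : 0 < alpha) (beta0 : 0 < beta).
Hypothesis (ab1 : alpha + beta = 1).

Local Notation T := (mean_op Omega eps alpha beta).

Let alpha_ge0 : 0 <= alpha. Proof. exact: ltW. Qed.
Let beta_ge0 : 0 <= beta. Proof. exact: ltW. Qed.

Context (u0 : 'rV[R]_n -> R) (m : R).
Hypotheses (bu0 : bounded_borel u0) (u0m : forall x, m <= u0 x).
Hypothesis u0O : forall x, Omega x -> u0 x = m.

Local Notation u_ := (fun k => iter k T u0).

Lemma bounded_borel_iter k : bounded_borel (u_ k).
Proof. by elim: k => //= k IH; exact: bounded_borel_mean_op. Qed.

Lemma iter_mean_op_bound C : (forall x, `|u0 x| <= C) ->
  forall k x, `|u_ k x| <= C.
Proof.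
move=> uC; elim=> //= k IH x.
by apply: mean_op_bound => //; exact: bounded_borel_iter.
Qed.

Lemma iter_mean_op_notin k x : ~ Omega x -> u_ k x = u0 x.
Proof. by move=> nO; elim: k => //= k <-; rewrite mean_op_notin. Qed.

(** Monotonicity propagates the inequality [u0 <= T u0], which holds because [u0]
    is the constant [m] on [Omega] and [m] is a minorant of [u0]. *)
Lemma iter_mean_op_leS k x : u_ k x <= u_ k.+1 x.
Proof.
elim: k x => [|k IH] x; last first.
  apply: le_mean_op => //; first exact: (bounded_borel_iter k.+1).
  exact: bounded_borel_iter.
have [Ox|nOx] := pselect (Omega x); last by rewrite /= mean_op_notin.
rewrite /= u0O// -(mean_op_cst eps0 Omega alpha beta ab1 m x).
by apply: le_mean_op => //; exact: bounded_borel_cst.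
Qed.

Definition iter_limit x : R := limn (fun k => u_ k x).

Lemma iter_limit_cvg x : (fun k => u_ k x) @ \oo --> iter_limit x.
Proof.
apply: nondecreasing_is_cvgn; first by apply/nondecreasing_seqP => k; exact: iter_mean_op_leS.
have [C uC] := bu0.2; exists C => _ [k _ <-].
by rewrite (le_trans (ler_norm _))// iter_mean_op_bound.
Qed.

Lemma iter_le_limit k x : u_ k x <= iter_limit x.
Proof.
apply: (nondecreasing_cvgn_le _ _ k).
  by apply/nondecreasing_seqP => j; exact: iter_mean_op_leS.
by apply/cvg_ex; exists (iter_limit x); exact: iter_limit_cvg.
Qed.

Lemma iter_limit_notin x : ~ Omega x -> iter_limit x = u0 x.
Proof.
move=> nO; apply/cvg_lim => //.
by under eq_fun do rewrite iter_mean_op_notin//; exact: cvg_cst.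
Qed.

Lemma iter_limit_bound C : (forall x, `|u0 x| <= C) ->
  forall x, `|iter_limit x| <= C.
Proof.
move=> uC x; rewrite -(cvg_lim (@Rhausdorff R) (cvg_norm (iter_limit_cvg x))).
apply: limr_le.
  by apply/cvg_ex; exists `|iter_limit x|; apply: cvg_norm; exact: iter_limit_cvg.
by near=> k; exact: iter_mean_op_bound.
Unshelve. all: by end_near. Qed.

Lemma bounded_borel_iter_limit : bounded_borel iter_limit.
Proof.
split; last by have [C uC] := bu0.2; exists C; exact: iter_limit_bound.
apply: (measurable_fun_cvg (h := u_)) => [k|x _]; last exact: iter_limit_cvg.
by have [] := bounded_borel_iter k.
Qed.

(** Pass to the limit in [u_ k <= u_ k.+1 = T (u_ k) <= T u]. *)
Lemma iter_limit_le_mean_op x : iter_limit x <= T iter_limit x.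
Proof.
apply: limr_le.
  by apply/cvg_ex; exists (iter_limit x); exact: iter_limit_cvg.
near=> k; apply: (le_trans (iter_mean_op_leS k x)); apply: le_mean_op => //.
- exact: bounded_borel_iter_limit.
- exact: bounded_borel_iter.
- by move=> y; exact: iter_le_limit.
Unshelve. all: by end_near. Qed.

Let gap k := \int[lebesgue_rV n]_(y in Omega) (iter_limit y - u_ k y).

Lemma gap_cvg0 : gap @ \oo --> (0 : R).
Proof.
have [C uC] := bu0.2.
rewrite -[0 : R]/(fine 0%:E).
apply: (fine_cvg (f := fun k =>
  (\int[lebesgue_rV n]_(y in Omega) (iter_limit y - u_ k y)%:E)%E)).
rewrite [X in _ --> X](_ : _ = (\int[lebesgue_rV n]_(y in Omega) (cst 0 y))%E); last first.
  by rewrite integral0.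
apply: (dominated_cvg mO (g := fun _ => (C + C)%:E)) => //.
- move=> k; apply/measurable_EFinP; apply: measurable_funTS.
  apply: measurable_funB; [exact: bounded_borel_iter_limit.1|].
  exact: (bounded_borel_iter k).1.
- move=> x _; apply: cvg_EFin; first by near=> k.
  rewrite (_ : fine \o _ = fun k => iter_limit x - u_ k x)//.
  rewrite -[X in _ --> X](subrr (iter_limit x)).
  by apply: cvgB; [exact: cvg_cst|exact: iter_limit_cvg].
- by apply: (bounded_borel_integrable (cst (C + C))) => //; exact: bounded_borel_cst.
- move=> k x _; rewrite /= lee_fin (le_trans (ler_normB _ _))// lerD//.
    exact: iter_limit_bound.
  exact: iter_mean_op_bound.
Unshelve. all: by end_near. Qed.

Let vol0 : R := (eps / n.+1%:R *+ 2) ^+ n.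

(** Contraction by [alpha] up to an error that does not depend on [x]: the
    integral over the ball at [x] is at most the one over [Omega], since the
    integrand vanishes elsewhere, and the volume of the ball is at least [vol0]. *)
Lemma mean_op_sub_iterS k x M : Omega x ->
  (forall y, iter_limit y - u_ k y <= M) ->
  T iter_limit x - u_ k.+1 x <= alpha * M + beta / vol0 * gap k.
Proof.
move=> Ox uM; rewrite lerBlDl.
have bk := bounded_borel_iter k; have bl := bounded_borel_iter_limit.
apply: (le_trans (mean_op_leD eps0 _ _ _ alpha_ge0 _ _ M _ bk bl Ox _)).
  by move=> y _; rewrite -lerBlDl.
rewrite lerD2l lerD2l; apply: ler_pM.
- by rewrite divr_ge0// fine_ge0.
- by apply: Rintegral_ge0 => y _; rewrite subr_ge0 iter_le_limit.
- rewrite ler_wpM2l// lef_pV2 ?posrE ?volume_euclid_ball_gt0//.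
    exact: le_volume_euclid_ball.
  by rewrite exprn_gt0// pmulrn_lgt0// divr_gt0.
apply: (ge0_le_Rintegral_support (iter_limit \- u_ k)) => //.
- exact: bounded_borelB.
- exact: measurable_euclid_ball.
- exact: lebesgue_euclid_ball_lty.
- by move=> y; rewrite subr_ge0 iter_le_limit.
- by move=> y nO /=; rewrite iter_limit_notin// iter_mean_op_notin// subrr.
Qed.

(** One sequence [M] controls both [u - u_ k] and [T u - u_ k.+1]: the first gives
    uniform convergence, the second [T u <= u]. *)
Lemma mean_op_iter_cvg : exists M : R ^nat, M @ \oo --> (0 : R) /\
  forall k x, iter_limit x - u_ k x <= M k /\ T iter_limit x - u_ k.+1 x <= M k.+1.
Proof.
have [C uC] := bu0.2.
pose c k := beta / vol0 * gap k.
pose M := fix M k := if k is j.+1 then alpha * M j + c j else C + C.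
have c0 k : 0 <= c k.
  rewrite mulr_ge0 ?divr_ge0//.
    by rewrite exprn_ge0// mulrn_wge0// divr_ge0// ltW.
  by apply: Rintegral_ge0 => y _; rewrite subr_ge0 iter_le_limit.
have M0 k : 0 <= M k.
  elim: k => /= [|k IH]; last by rewrite addr_ge0// mulr_ge0.
  by rewrite addr_ge0// (le_trans _ (uC 0)).
have step k : (forall x, iter_limit x - u_ k x <= M k) ->
    forall x, T iter_limit x - u_ k.+1 x <= M k.+1.
  move=> IH x; have [Ox|nOx] := pselect (Omega x).
    exact: mean_op_sub_iterS.
  by rewrite mean_op_notin// iter_limit_notin// iter_mean_op_notin// subrr.
have le_M k x : iter_limit x - u_ k x <= M k.
  elim: k x => [|k IH] x.
    have := iter_limit_bound C uC x; have := uC x.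
    by rewrite !ler_norml => /andP[? ?] /andP[? ?] /=; lra.
  by apply: le_trans (step _ IH x); rewrite lerD2r iter_limit_le_mean_op.
exists M; split; last by move=> k x; split; [exact: le_M|exact/step/le_M].
apply: (cvg0_affine_recurrence _ c alpha) => //.
  (* [alpha < 1] because [beta] is positive. *)
  by rewrite alpha_ge0 -ab1 ltrDl.
rewrite -(mulr0 (beta / vol0)); apply: cvgM; first exact: cvg_cst.
exact: gap_cvg0.
Qed.

Lemma mean_op_iter_limit x : T iter_limit x = iter_limit x.
Proof.
apply/eqP; rewrite eq_le iter_limit_le_mean_op andbT.
have [M [M0 uM]] := mean_op_iter_cvg.
apply/ler_addgt0Pr => e e0.
have [N _ /(_ N.+1 (leqnSn _))] : \forall k \near \oo, `|0 - M k| < e.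
  by move/cvgrPdist_lt : M0; apply.
rewrite /= sub0r normrN => /(le_lt_trans (ler_norm _)) MN.
have [_ h] := uM N x; have := iter_le_limit N.+1 x => /= h'.
by rewrite /= in h; lra.
Qed.

Lemma iter_mean_op_uniform e : 0 < e ->
  \forall k \near \oo, forall x, `|iter_limit x - u_ k x| < e.
Proof.
move=> e0; have [M [M0 uM]] := mean_op_iter_cvg.
have : \forall k \near \oo, `|0 - M k| < e by move/cvgrPdist_lt : M0; apply.
apply: filterS => k; rewrite sub0r normrN => Mk x.
rewrite ger0_norm ?subr_ge0 ?iter_le_limit//.
by apply: le_lt_trans (le_lt_trans (ler_norm _) Mk); have [] := uM k x.
Qed.

End iteration.

(** * Reduction to functions on the whole space *)

Section locality.
Context {R : realType} {n : nat}.
Context (Omega : set 'rV[R]_n) (eps alpha beta : R).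

(** The ball of radius [eps] around a point of [Omega] lies in the extended
    domain. *)
Lemma eq_in_mean_op u v : {in extended_domain Omega eps, u =1 v} ->
  {in extended_domain Omega eps,
    mean_op Omega eps alpha beta u =1 mean_op Omega eps alpha beta v}.
Proof.
move=> uv x xE; rewrite /mean_op; case: ifPn => [/set_mem Ox|_]; last exact: uv.
have uvB y : euclid_ball x eps y -> u y = v y.
  by move=> xy; apply/uv/mem_set/(euclid_ball_sub_extended _ _ _ Ox).
rewrite (@eq_imagel _ _ (euclid_ball x eps) u v)//.
by congr (_ + _ * _); apply: eq_Rintegral => y /set_mem; exact: uvB.
Qed.

Lemma eq_in_iter_mean_op u v k : {in extended_domain Omega eps, u =1 v} ->
  {in extended_domain Omega eps,
    iter k (mean_op Omega eps alpha beta) u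
    =1 iter k (mean_op Omega eps alpha beta) v}.
Proof. by move=> uv; elim: k => //= k IH; exact: eq_in_mean_op. Qed.

End locality.

Section extension.
Context {R : realType} {n : nat}.

Implicit Types (A : set 'rV[R]_n) (F : 'rV[R]_n -> R).

(** The value [inf F] outside of [A] makes [inf F] a minorant everywhere, and
    makes the extension agree with the starting point of the iteration on
    [Omega] as well. *)
Definition extend_inf A F x : R :=
  if x \in A then F x else inf (F @` A).

Lemma inf_le_extend_inf A F : [bounded F x | x in A] ->
  forall x, inf (F @` A) <= extend_inf A F x.
Proof.
move=> /ex_strict_bound_gt0[M _ FM] x.
rewrite /extend_inf; case: ifPn => // /set_mem Ax.
apply: ge_inf; last by exists x.
exists (- M) => _ [y Ay <-].
by have := FM y Ay; rewrite /= ltr_norml => /andP[/ltW].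
Qed.

Lemma bounded_borel_extend_inf A F : measurable A ->
  [bounded F x | x in A] -> measurable_fun A F ->
  bounded_borel (extend_inf A F).
Proof.
move=> mA /ex_strict_bound_gt0[M M0 FM] mF.
have AE : (fun x : 'rV[R]_n => x \in A) @^-1` [set true] = A.
  by apply/seteqP; split => x /=; [move/set_mem|move/mem_set].
split.
  apply: measurable_fun_if => //; last by rewrite setTI AE.
  by apply: (measurable_fun_bool true); rewrite setTI AE.
exists (M + `|inf (F @` A)|) => x.
rewrite /extend_inf; case: ifPn => [/set_mem Ax|_].
  by apply: (le_trans (ltW (FM x Ax))); rewrite lerDl.
by rewrite lerDr ltW.
Qed.

End extension.

Theorem theorem2p1 (R : realType) (n : nat) (Omega : set 'rV[R]_n)
    (eps alpha beta : R) (F : 'rV[R]_n -> R) :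
  (0 < n)%N ->
  domain Omega -> bounded_set Omega ->
  0 < eps -> 0 < alpha -> 0 < beta -> alpha + beta = 1 ->
  [bounded F x | x in boundary_strip Omega eps] ->
  measurable_fun (boundary_strip Omega eps) F ->
  exists u : 'rV[R]_n -> R,
    [/\ [bounded u x | x in extended_domain Omega eps],
        measurable_fun (extended_domain Omega eps) u,
        (forall x, extended_domain Omega eps x ->
           u x = mean_op Omega eps alpha beta u x),
        (forall x, boundary_strip Omega eps x -> u x = F x) &
        {uniform extended_domain Omega eps,
          (fun j : nat => iter j (mean_op Omega eps alpha beta)
                            (initial_fun Omega eps F)) @ \oo --> u}].
Proof.
move=> _ dO bO eps0 alpha0 beta0 ab1 bF mF.
have mO : measurable Omega by apply: open_measurable_rV; case: dO.
have Ooo := bounded_set_lebesgue_lty _ mO bO.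
have mS : measurable (boundary_strip Omega eps) by exact: measurable_boundary_strip.
set S := boundary_strip Omega eps in bF mF mS *.
set m := inf (F @` S).
set u0 := extend_inf S F.
have bu0 : bounded_borel u0 by exact: bounded_borel_extend_inf.
have u0m : forall x, m <= u0 x by exact: inf_le_extend_inf.
have u0O x : Omega x -> u0 x = m.
  by move=> Ox; rewrite /u0 /extend_inf memNset// => -[].
have u0E : {in extended_domain Omega eps, initial_fun Omega eps F =1 u0}.
  move=> x /set_mem xE; rewrite /initial_fun; case: ifPn => [/set_mem Ox|nO].
    by rewrite u0O.
  case: xE => [Sx|Ox]; last by rewrite mem_set in nO.
  by rewrite /u0 /extend_inf mem_set.
pose u := iter_limit Omega eps alpha beta u0.
have [mu [C uC]] : bounded_borel u by exact: bounded_borel_iter_limit.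
exists u; split.
- exists C; split; first exact: num_real.
  by move=> M CM x _; exact: le_trans (uC x) (ltW CM).
- exact: measurable_funTS.
- by move=> x _; rewrite /u (mean_op_iter_limit _ _ _ _ mO Ooo eps0 alpha0 beta0 ab1 _ m).
- move=> x Sx; rewrite /u iter_limit_notin//; last by case: Sx.
  by rewrite /u0 /extend_inf mem_set.
move=> P /uniform_nbhs[E [entE EP]].
have [e /= e0 eE] := entE.
have := iter_mean_op_uniform _ _ _ _ mO Ooo eps0 alpha0 beta0 ab1 _ m bu0 u0m u0O e e0.
apply: filterS => k uk; apply: EP => x xE; apply: eE => /=.
by rewrite (eq_in_iter_mean_op _ _ _ _ _ _ _ u0E) ?mem_set//; exact: uk.
Qed.
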